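(* Assume that $\tilde{\mathcal S}$ is a crossed projection. In the case where $\chi_1$ is an edge, if $$\det(\tilde X_1\ \tilde X_2)\det(\tilde X_3\ \tilde X_4)<0\quad\text{and}\quad\det(\tilde X_2\ \tilde X_3)\det(\tilde X_4\ \tilde X_1)>0,$$ then a unique sliding vector field is defined on the codimension-2 discontinuity $\Lambda$ (at $(x,0,0)$) of the piecewise smooth system $(X_1,X_2,X_3,X_4)$. In the case where $\chi_1$ is a diagonal, if $$\det(\tilde X_1\ \tilde X_2)\det(\tilde X_3\ \tilde X_4)>0\quad\text{and}\quad\det(\tilde X_2\ \tilde X_3)\det(\tilde X_4\ \tilde X_1)<0,$$ then a unique sliding vector field is defined on $\Lambda$ (at $(x,0,0)$).
   Context: Setting. Let $\mathcal U\subset\mathbb R^3$ with coordinates $(x,y,z)$, $\mathcal I$ an interval, $\Lambda=\{(x,0,0):x\in\mathcal I\}$, $\mathcal Q_1=\{y\ge0,z\ge0\}$, $\mathcal Q_2=\{y\le0,z\ge0\}$, $\mathcal Q_3=\{y\le0,z\le0\}$, $\mathcal Q_4=\{y\ge0,z\le0\}$. The piecewise smooth system is $(\dot x,\dot y,\dot z)^T=X_i$ on $\mathcal Q_i$ with smooth $X_i=(\alpha_i,\beta_i,\gamma_i)^T$; standing assumption: $\alpha_i,\beta_i,\gamma_i$ depend only on $x$. Fix $x\in\mathcal I$ and let $\tilde X_i=(\beta_i,\gamma_i)^T\in\mathbb R^2$ be evaluated at $x$. $\det(a\ b)$ is the determinant of the matrix with columns $a,b$. For $(\psi,\phi)\in(-1,1)^2$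 let $$\tilde F_x(\psi,\phi)=\tfrac12\Big(\tfrac{\tilde X_1}{2}(1+\phi)+\tfrac{\tilde X_4}{2}(1-\phi)\Big)(1+\psi)+\tfrac12\Big(\tfrac{\tilde X_2}{2}(1+\phi)+\tfrac{\tilde X_3}{2}(1-\phi)\Big)(1-\psi),$$ and $\tilde{\mathcal S}=\tilde F_x((-1,1)^2)$. Sliding. Sliding vector fields at $(x,0,0)$ correspond to zeros $(\psi_*,\phi_* )\in(-1,1)^2$ of $\tilde F_x$: with $\sigma_\psi=(1+\psi_* )/2$, $\sigma_\phi=(1+\phi_* )/2$, the sliding vector field has $x$-component $\sigma_\psi\sigma_\phi\alpha_1+(1-\sigma_\psi)\sigma_\phi\alpha_2+(1-\sigma_\psi)(1-\sigma_\phi)\alpha_3+\sigma_\psi(1-\sigma_\phi)\alpha_4$ and vanishing $y,z$-components. ''Unique'' means exactly one such zero. Projection type. With indices mod 4, let $\chi_i=\tilde X_{i+1}-\tilde X_i$ and $\delta_i=\det(\chi_i\ \chi_{i+1})$, $i=1,2,3,4$. $\tilde{\mathcal S}$ is a crossed projection if two of $\delta_1,\dots,\delta_4$ are positive and the other two are negative. In this case the closed polygon with successive vertices $\tilde X_1,\tilde X_2,\tilde X_3,\tilde X_4$ (endpoints of the vectors) is self-intersecting: two of its opposite sides cross, being the diagonals of the quadrilateral that is the convex hull of the four endpoints, while the other two sides are edges of this hull. ''$\chi_1$ is a diagonal'' means that the side $\tilde X_1\tilde X_2$ is one of the crossing sides (it crosses $\tilde X_3\tilde X_4$); ''$\chi_1$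 is an edge'' means it is not (so $\tilde X_2\tilde X_3$ and $\tilde X_4\tilde X_1$ cross). *)

(* Defs.v *)
From HB Require Import structures.
From mathcomp Require Import all_boot all_order all_algebra.
From mathcomp Require Import all_classical all_reals all_analysis.

Set Implicit Arguments.
Unset Strict Implicit.
Unset Printing Implicit Defensive.

Import Order.TTheory GRing.Theory Num.Theory.
Import numFieldNormedType.Exports.

Local Open Scope classical_set_scope.
Local Open Scope ring_scope.

(* The components of a point of R^3 are rows 0, 1 and 2 of a column vector.  The
   cyclic index i = 1, 2, 3, 4 is an element of 'Z_4, so that 4 = 0 and i + 1 is
   taken modulo 4. *)

Section Smoothness.
Variable R : realType.
Implicit Types (O A : set 'cV[R]_3) (f g : 'cV[R]_3 -> 'cV[R]_3).

Fixpoint iter_partial (s : seq 'I_3) f : 'cV[R]_3 -> 'cV[R]_3 :=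
  if s is j :: s' then fun p => 'D_(delta_mx j 0) (iter_partial s' f) p
  else f.

Definition smooth_on_open O f : Prop :=
  forall (s : seq 'I_3) (p : 'cV[R]_3), O p ->
    {for p, continuous (iter_partial s f)} /\
    forall j : 'I_3, derivable (iter_partial s f) p (delta_mx j 0).

(* On a set that need not be open, smooth means locally extendable: f is the
   restriction of a smooth map defined on an open neighbourhood of the set. *)
Definition smooth_on A f : Prop :=
  exists O g, [/\ open O, A `<=` O, smooth_on_open O g
                & forall p, A p -> f p = g p].

End Smoothness.

Section PiecewiseSmoothSystem.
Variable R : realType.

Definition point3 (x y z : R) : 'cV[R]_3 :=
  x *: delta_mx 0 0 + y *: delta_mx 1 0 + z *: delta_mx 2 0.

Definition quadrant (i : 'Z_4) : set 'cV[R]_3 :=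
  [set p | match val i with
           | 1%N => 0 <= p 1 0 /\ 0 <= p 2 0
           | 2%N => p 1 0 <= 0 /\ 0 <= p 2 0
           | 3%N => p 1 0 <= 0 /\ p 2 0 <= 0
           | _ (* i = 4 = 0 *) => 0 <= p 1 0 /\ p 2 0 <= 0
           end].

Record pws_system := PwsSystem {
  pws_dom : set 'cV[R]_3;
  pws_itv : interval R;
  pws_field :> 'Z_4 -> 'cV[R]_3 -> 'cV[R]_3;
  pws_Lambda_sub :
    [set point3 x 0 0 | x in [set` pws_itv]] `<=` pws_dom;
  pws_smooth : forall i : 'Z_4,
    smooth_on (pws_dom `&` quadrant i) (pws_field i);
  pws_only_x : forall (i : 'Z_4) (p q : 'cV[R]_3),
    (pws_dom `&` quadrant i) p -> (pws_dom `&` quadrant i) q ->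
    p 0 0 = q 0 0 -> pws_field i p = pws_field i q
}.

Variables (X : pws_system) (x : R).

Definition alpha (i : 'Z_4) : R := X i (point3 x 0 0) 0 0.

Definition Xtilde (i : 'Z_4) : 'cV[R]_2 :=
  \col_(k < 2) X i (point3 x 0 0) (lift ord0 k) 0.

Definition Ftilde (psi phi : R) : 'cV[R]_2 :=
  (1 + psi) *: (2^-1 *: ((1 + phi) *: (2^-1 *: Xtilde 1)
                         + (1 - phi) *: (2^-1 *: Xtilde 4)))
  + (1 - psi) *: (2^-1 *: ((1 + phi) *: (2^-1 *: Xtilde 2)
                           + (1 - phi) *: (2^-1 *: Xtilde 3))).

Definition sliding_vector (psi phi : R) : 'cV[R]_3 :=
  let s := (1 + psi) / 2 in
  let t := (1 + phi) / 2 in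
  point3 (s * t * alpha 1 + (1 - s) * t * alpha 2
          + (1 - s) * (1 - t) * alpha 3 + s * (1 - t) * alpha 4) 0 0.

Definition sliding (psi phi : R) (v : 'cV[R]_3) : Prop :=
  [/\ -1 < psi < 1, -1 < phi < 1, Ftilde psi phi = 0
    & v = sliding_vector psi phi].

(* Uniqueness is that of the zero of Ftilde, not merely of the vector v: two
   zeros giving the same v count as two sliding vector fields. *)
Definition unique_sliding : Prop :=
  exists! w : R * R * 'cV[R]_3, sliding w.1.1 w.1.2 w.2.

End PiecewiseSmoothSystem.

Section ProjectionType.
Variable R : realType.

Definition det2 (a b : 'cV[R]_2) : R := \det (row_mx a b : 'M[R]_2).

Variable V : 'Z_4 -> 'cV[R]_2.

Definition chi (i : 'Z_4) : 'cV[R]_2 := V (i + 1) - V i.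

Definition delta (i : 'Z_4) : R := det2 (chi i) (chi (i + 1)).

Definition crossed_projection : Prop :=
  #|[set i : 'Z_4 | 0 < delta i]%SET| = 2%N /\
  #|[set i : 'Z_4 | delta i < 0]%SET| = 2%N.

Definition segments_cross (a b c d : 'cV[R]_2) : Prop :=
  exists s t : R, [/\ 0 < s < 1, 0 < t < 1
    & (1 - s) *: a + s *: b = (1 - t) *: c + t *: d].

(* chi i is the side V i -- V (i + 1); the opposite side is
   V (i + 2) -- V (i + 3).  Only meaningful for a crossed projection. *)
Definition is_diagonal (i : 'Z_4) : Prop :=
  segments_cross (V i) (V (i + 1)) (V (i + 2)) (V (i + 3)).

Definition is_edge (i : 'Z_4) : Prop := ~ is_diagonal i.

End ProjectionType.

(* Main.v *)
Require Import Defs.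
From HB Require Import structures.
From mathcomp Require Import all_boot all_order all_algebra.
From mathcomp Require Import all_classical all_reals all_analysis.
From mathcomp Require Import ring lra.
From mathcomp Require polyrcf.

(**
Put [s = (1 + psi) / 2] and [t = (1 + phi) / 2].  A zero of [Ftilde] is a pair
[(s, t)] with [t A(s) + (1 - t) B(s) = 0], where [A(s)] runs along [X1 X2] and
[B(s)] along [X4 X3].  When [X1 X2] is an edge, [det(A(s), B(s))] is a quadratic
Bernstein form in [s] whose end coefficients have opposite signs, so [A] and [B]
are collinear for exactly one [s] in [(0, 1)].  If they pointed in the same
direction, the line through 0 and [A(s)] would separate the segments [X2 X3] and
[X4 X1], which cross; so they point in opposite directions and [t] is determined.
The case where [X1 X2] is a diagonal reduces to this one by exchanging [X2] with
[X4] and [s] with [t].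
*)

Set Implicit Arguments.
Unset Strict Implicit.
Unset Printing Implicit Defensive.

Import Order.TTheory GRing.Theory Num.Theory.

Local Open Scope ring_scope.

(** * Plane vectors and determinants in coordinates *)

Lemma cV2_eqP (R : realType) (a b : 'cV[R]_2) :
  a = b <-> a 0 0 = b 0 0 /\ a 1 0 = b 1 0.
Proof.
split=> [-> //|[e0 e1]]; apply/colP; case=> [[|[|//]] i].
- by have -> : Ordinal i = 0 by apply/val_inj.
- by have -> : Ordinal i = 1 by apply/val_inj.
Qed.

Lemma det2E (R : realType) (a b : 'cV[R]_2) :
  det2 a b = a 0 0 * b 1 0 - a 1 0 * b 0 0.
Proof.
have m0 i : (row_mx a b : 'M[R]_2) i 0 = a i 0.
  by rewrite -[RHS](row_mxEl a b); congr (row_mx _ _ _ _); apply/val_inj.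
have m1 i : (row_mx a b : 'M[R]_2) i 1 = b i 0.
  by rewrite -[RHS](row_mxEr a b); congr (row_mx _ _ _ _); apply/val_inj.
rewrite /det2; move: (row_mx a b : 'M[R]_2) m0 m1 => m m0 m1.
rewrite (expand_det_row _ 0) !big_ord_recl big_ord0 /cofactor !det_mx11 !mxE.
have -> : lift 0 0 = 1 :> 'I_2 by apply/val_inj.
have -> : lift 1 0 = 0 :> 'I_2 by apply/val_inj.
by rewrite m0 !m1 m0 /=; ring.
Qed.

(** * Roots of quadratic Bernstein forms *)

(** Eliminating [b] between the two equations leaves [s - s'] times a factor that cannot vanish,
    because [a] and [c] have opposite signs. *)
Lemma bernstein2_root_unique (R : realFieldType) (a b c s s' : R) :
  a * c < 0 -> 0 < s < 1 -> 0 < s' < 1 ->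
  s ^+ 2 * a + s * (1 - s) * b + (1 - s) ^+ 2 * c = 0 ->
  s' ^+ 2 * a + s' * (1 - s') * b + (1 - s') ^+ 2 * c = 0 ->
  s = s'.
Proof.
move=> ac /andP[s0 s1] /andP[s'0 s'1] e e'.
have : (s - s') * (s * s' * a - (1 - s) * (1 - s') * c) = 0.
  by move: (congr1 ( *%R (s' * (1 - s'))) e) (congr1 ( *%R (s * (1 - s))) e'); lra.
move/eqP; rewrite mulf_eq0 subr_eq0 => /orP[/eqP //|/eqP].
have ss : 0 < s * s' by exact: mulr_gt0.
have tt : 0 < (1 - s) * (1 - s') by rewrite mulr_gt0 // subr_gt0.
have [a0|a0|a0] := ltrgtP a 0; last by rewrite a0 mul0r ltxx in ac.
- have : 0 < c by rewrite -(nmulr_rlt0 _ a0).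
  by move: ss tt; nra.
- have : c < 0 by rewrite -(pmulr_rlt0 _ a0).
  by move: ss tt; nra.
Qed.

(** Intermediate value theorem: the form equals [c] at 0 and [a] at 1. *)
Lemma bernstein2_root (R : rcfType) (a b c : R) : a * c < 0 ->
  exists2 s, 0 < s < 1 & s ^+ 2 * a + s * (1 - s) * b + (1 - s) ^+ 2 * c = 0.
Proof.
move=> ac.
pose p : {poly R} := a *: 'X^2 + b *: ('X * (1 - 'X)) + c *: (1 - 'X) ^+ 2.
have pE s : p.[s] = s ^+ 2 * a + s * (1 - s) * b + (1 - s) ^+ 2 * c.
  by rewrite !(hornerD, hornerZ, hornerM, hornerXn, hornerX, hornerN, hornerC,
    horner_exp); ring.
have [|s s01 /rootP ps] := @polyrcf.poly_ivtoo R p 0 1 ler01.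
- by rewrite !pE; move: ac; lra.
exists s; first by rewrite in_itv in s01.
by rewrite -pE.
Qed.

(** * Zeros of the bilinear interpolation *)

Lemma collinear_exists_scale (R : realType) (a b : 'cV[R]_2) :
  a != 0 -> det2 a b = 0 -> exists k, b = k *: a.
Proof.
rewrite det2E => a0 ab.
have n0 : a 0 0 ^+ 2 + a 1 0 ^+ 2 != 0.
  apply: contra a0; rewrite paddr_eq0 ?sqr_ge0 // !sqrf_eq0 => /andP[/eqP e0 /eqP e1].
  by apply/eqP/cV2_eqP; rewrite !mxE.
(* The coefficient of the orthogonal projection of [b] onto [a]. *)
exists ((a 0 0 * b 0 0 + a 1 0 * b 1 0) / (a 0 0 ^+ 2 + a 1 0 ^+ 2)).
apply/cV2_eqP; rewrite !mxE; split; rewrite mulrAC; apply: (canRL (mulfK n0)).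
- by move: (congr1 ( *%R (a 1 0)) ab); lra.
- by move: (congr1 ( *%R (a 0 0)) ab); lra.
Qed.

Definition bilinear_interp (R : realType) (X1 X2 X3 X4 : 'cV[R]_2) (s t : R) :=
  t *: (s *: X1 + (1 - s) *: X2) + (1 - t) *: (s *: X4 + (1 - s) *: X3).

(* A nonnegative ratio [k] would make [det2 A] positive on one of the two crossing
   segments and negative on the other. *)
Lemma crossing_ratio_neg (R : realType) (X1 X2 X3 X4 : 'cV[R]_2) (s k : R) :
  segments_cross X2 X3 X4 X1 -> det2 X1 X2 * det2 X3 X4 < 0 -> 0 < s < 1 ->
  s *: X4 + (1 - s) *: X3 = k *: (s *: X1 + (1 - s) *: X2) -> k < 0.
Proof.
move=> [p [q [/andP[p0 p1] /andP[q0 q1] M]]] dd /andP[s0 s1] BA.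
set A := s *: X1 + _ in BA; rewrite ltNge; apply/negP => k0.
have f1 : det2 A X1 = - ((1 - s) * det2 X1 X2) by rewrite !det2E !mxE; ring.
have f2 : det2 A X2 = s * det2 X1 X2 by rewrite !det2E !mxE; ring.
(* [k *: A] lies on the line [X4 X3], so the determinant reduces to [det2 X3 X4]. The factor [k] is
   kept because [k = 0] is not excluded yet. *)
have f3 : k * det2 A X3 = - (s * det2 X3 X4).
  have -> : k * det2 A X3 = det2 (k *: A) X3 by rewrite !det2E !mxE; ring.
  by rewrite -BA !det2E !mxE; ring.
have f4 : k * det2 A X4 = (1 - s) * det2 X3 X4.
  have -> : k * det2 A X4 = det2 (k *: A) X4 by rewrite !det2E !mxE; ring.
  by rewrite -BA !det2E !mxE; ring.
have fM : (1 - p) * det2 A X2 + p * det2 A X3 = (1 - q) * det2 A X4 + q * det2 A X1.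
  have -> : (1 - p) * det2 A X2 + p * det2 A X3 = det2 A ((1 - p) *: X2 + p *: X3).
    by rewrite !det2E !mxE; ring.
  by rewrite M !det2E !mxE; ring.
set d := det2 X1 X2 in dd f1 f2; set e := det2 X3 X4 in dd f3 f4.
have : k * d * ((1 - p) * s + q * (1 - s)) = e * ((1 - q) * (1 - s) + p * s).
  move: (congr1 ( *%R k) fM); rewrite f1 f2 !mulrDr !(mulrCA k) f3 f4; lra.
have c1 : 0 < (1 - p) * s + q * (1 - s).
  by apply: addr_gt0; apply: mulr_gt0; rewrite ?subr_gt0.
have c2 : 0 < (1 - q) * (1 - s) + p * s.
  by apply: addr_gt0; apply: mulr_gt0; rewrite ?subr_gt0.
(* After multiplication by [d], the left side carries [k * d ^+ 2] and is nonnegative, while the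
   right side carries [d * e] and is negative. *)
move=> /(congr1 ( *%R d)).
have : 0 <= k * d ^+ 2 * ((1 - p) * s + q * (1 - s)).
  by rewrite mulr_ge0 ?(ltW c1) // mulr_ge0 ?sqr_ge0.
have : d * e * ((1 - q) * (1 - s) + p * s) < 0 by rewrite nmulr_rlt0.
lra.
Qed.

Lemma bilinear_interp_unique_zero (R : realType) (X1 X2 X3 X4 : 'cV[R]_2) :
  segments_cross X2 X3 X4 X1 ->
  det2 X1 X2 * det2 X3 X4 < 0 -> 0 < det2 X2 X3 * det2 X4 X1 ->
  exists! w : R * R, [/\ 0 < w.1 < 1, 0 < w.2 < 1
                       & bilinear_interp X1 X2 X3 X4 w.1 w.2 = 0].
Proof.
move=> cr d1 d2.
pose A s := s *: X1 + (1 - s) *: X2; pose B s := s *: X4 + (1 - s) *: X3.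
have d12 : det2 X1 X2 != 0 by apply: contraTneq d1 => ->; rewrite mul0r ltxx.
have A0 s : A s != 0.
  have AX : det2 X1 (A s) = (1 - s) * det2 X1 X2 /\ det2 (A s) X2 = s * det2 X1 X2.
    by split; rewrite !det2E !mxE; ring.
  apply/eqP => As; move: AX; rewrite As !det2E !mxE !(mulr0, mul0r) subrr -det2E.
  (* The two determinants in [AX] add up to [det2 X1 X2], so they cannot both vanish. *)
  by case=> e1 e2; move/eqP: d12; apply; rewrite -[LHS]mul1r; lra.
have detAB s : det2 (A s) (B s) = s ^+ 2 * det2 X1 X4 +
    s * (1 - s) * (det2 X1 X3 + det2 X2 X4) + (1 - s) ^+ 2 * det2 X2 X3.
  by rewrite !det2E !mxE; ring.
have ac : det2 X1 X4 * det2 X2 X3 < 0.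
  have -> : det2 X1 X4 = - det2 X4 X1 by rewrite !det2E; ring.
  by rewrite mulNr oppr_lt0 mulrC.
have [s s01 sE] := bernstein2_root (det2 X1 X3 + det2 X2 X4) ac.
rewrite -detAB in sE.
have [k Bk] := collinear_exists_scale (A0 s) sE.
have k0 := crossing_ratio_neg cr d1 s01 Bk.
have k1 : 1 - k != 0 by apply/eqP; lra.
have F0 t : bilinear_interp X1 X2 X3 X4 s t = (t + (1 - t) * k) *: A s.
  by rewrite /bilinear_interp -/(A s) -/(B s) Bk scalerA -scalerDl.
(* The root of [t + (1 - t) * k = 0], which lies in [(0, 1)] because [k < 0]. *)
exists (s, - k / (1 - k)); split=> [|[s' t']] /=.
- split=> //; first by rewrite divr_gt0 ?ltr_pdivrMr; lra.
  rewrite F0 (_ : _ + _ = 0) ?scale0r //; field.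
  exact: k1.
- case=> s'01 t'01 F.
  have ss' : s = s'.
    apply: (bernstein2_root_unique (b := det2 X1 X3 + det2 X2 X4) ac s01 s'01);
      rewrite -detAB //.
    have [t0 t1] := andP t'01.
    (* Taking the determinant with [A s'] removes the [A s'] term of the interpolation. *)
    have : (1 - t') * det2 (A s') (B s') = 0.
      have -> : (1 - t') * det2 (A s') (B s') =
          det2 (A s') (bilinear_interp X1 X2 X3 X4 s' t').
        by rewrite !det2E !mxE; ring.
      by rewrite F det2E !mxE !mulr0 subrr.
    by move/eqP; rewrite mulf_eq0 subr_eq0 => /orP[/eqP|/eqP //]; lra.
  move: F; rewrite -ss' F0 => /eqP; rewrite scaler_eq0 (negPf (A0 s)) orbF => /eqP tk.
  congr pair; apply: (canLR (mulfK k1)); lra.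
Qed.

(** * Crossing sides of a crossed projection *)

(** Dividing by the common sum turns the weights into convex ones, even if they are all negative. *)
Lemma segments_cross_weights (R : realType) (a b c d : 'cV[R]_2) (p q r u : R) :
  0 < p * q -> 0 < r * u -> p + q = r + u ->
  p *: a + q *: b = r *: c + u *: d -> segments_cross a b c d.
Proof.
move=> pq ru e E.
have frac (v w : R) : 0 < v * w ->
  [/\ v + w != 0, 0 < w / (v + w) < 1 & 1 - w / (v + w) = v / (v + w)].
  move=> vw; have n : v + w != 0 by apply/eqP => /eqP; rewrite addr_eq0 => /eqP h;
    move: vw; rewrite h; nra.
  split=> //; last by field.
  (* This makes the denominator positive whatever the sign of [v + w]. *)
  have -> : w / (v + w) = w * (v + w) / (v + w) ^+ 2 by field.
  have n2 : 0 < (v + w) ^+ 2 by rewrite exprn_even_gt0.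
  have w2 := sqr_ge0 w; have v2 : 0 < v ^+ 2.
    by rewrite exprn_even_gt0 //; apply: contraTneq vw => ->; rewrite mul0r ltxx.
  apply/andP; split; first by rewrite divr_gt0 //; lra.
  by rewrite ltr_pdivrMr //; lra.
have [n1 s01 sE] := frac _ _ pq; have [n2 t01 tE] := frac _ _ ru.
exists (q / (p + q)), (u / (r + u)); split=> //.
by rewrite sE tE ![_ / _]mulrC -!scalerA -!scalerDr E e.
Qed.

(** Since [is_edge] is only a negation, this dichotomy is what provides the crossing of the other
    two sides in the edge case. *)
Lemma crossed_projection_cross (R : realType) (V : 'Z_4 -> 'cV[R]_2) :
  crossed_projection V ->
  segments_cross (V 1) (V 2) (V 3) (V 4) \/ segments_cross (V 2) (V 3) (V 4) (V 1).
Proof.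
have e40 : (4 : 'Z_4) = 0 by apply/val_inj.
have e41 : (4 + 1 : 'Z_4) = 1 by apply/val_inj.
have e21 : (2 + 1 : 'Z_4) = 3 by apply/val_inj.
have e31 : (3 + 1 : 'Z_4) = 4 by apply/val_inj.
have e11 : (1 + 1 : 'Z_4) = 2 by apply/val_inj.
have sumD : delta V 1 + delta V 3 = delta V 2 + delta V 4.
  by rewrite /delta /chi !(e11, e21, e31, e41) !det2E !mxE; ring.
(* If two deltas have one sign and two the other, [sumD] forces [delta 1] and
   [delta 3] to have opposite signs; [radon] then writes the crossing point as a
   convex combination of the end points of each of two opposite sides. *)
have radon : delta V 2 *: V 1 - delta V 3 *: V 2 + delta V 4 *: V 3
    - delta V 1 *: V 4 = 0.
  by apply/cV2_eqP; rewrite /delta /chi !(e11, e21, e31, e41) !det2E !mxE; split; ring.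
have cardE (P : pred 'Z_4) :
    #|[set i | P i]%SET| = (P 1%R + P 2%R + P 3%R + P 4%R)%N.
  rewrite cardsE -sum1_card big_mkcond !big_ord_recl big_ord0 /=.
  have -> : lift ord0 ord0 = 1 :> 'Z_4 by apply/val_inj.
  have -> : lift ord0 (lift ord0 ord0) = 2 :> 'Z_4 by apply/val_inj.
  have -> : lift ord0 (lift ord0 (lift ord0 ord0)) = 3 :> 'Z_4 by apply/val_inj.
  rewrite e40 /= -[ord0]/(0 : 'Z_4) !unfold_in.
  by case: (P 0) (P 1) (P 2) (P 3) => [] [] [] [].
have cross12 : delta V 1 * delta V 4 < 0 -> delta V 2 * delta V 3 < 0 ->
    segments_cross (V 1) (V 2) (V 3) (V 4).
  move=> h1 h2; apply: (@segments_cross_weights _ _ _ _ _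
    (delta V 2) (- delta V 3) (- delta V 4) (delta V 1));
    [clear -h1 h2; lra|clear -h1 h2; lra|clear -sumD; lra|].
  move/cV2_eqP: radon => []; rewrite !mxE => r0 r1.
  by apply/cV2_eqP; rewrite !mxE; split; lra.
have cross23 : delta V 1 * delta V 2 < 0 -> delta V 3 * delta V 4 < 0 ->
    segments_cross (V 2) (V 3) (V 4) (V 1).
  move=> h1 h2; apply: (@segments_cross_weights _ _ _ _ _
    (- delta V 3) (delta V 4) (delta V 1) (- delta V 2));
    [clear -h1 h2; lra|clear -h1 h2; lra|clear -sumD; lra|].
  move/cV2_eqP: radon => []; rewrite !mxE => r0 r1.
  by apply/cV2_eqP; rewrite !mxE; split; lra.
rewrite /crossed_projection !cardE => -[].
case: (ltrgtP 0 (delta V 1)) => d1; case: (ltrgtP 0 (delta V 2)) => d2;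
  case: (ltrgtP 0 (delta V 3)) => d3; case: (ltrgtP 0 (delta V 4)) => d4 //= _ _.
(* Of the six sign patterns with two signs of each kind, [sumD] excludes the two alternating
   ones. *)
all: try (exfalso; clear -sumD d1 d2 d3 d4; lra).
all: first [by left; apply: cross12; clear -d1 d2 d3 d4; nra
           | by right; apply: cross23; clear -d1 d2 d3 d4; nra].
Qed.

(** * From the interpolation to sliding vector fields *)

Lemma FtildeE (R : realType) (X : pws_system R) (x psi phi : R) :
  Ftilde X x psi phi =
    bilinear_interp (Xtilde X x 1) (Xtilde X x 2) (Xtilde X x 3) (Xtilde X x 4)
      ((1 + psi) / 2) ((1 + phi) / 2).
Proof. by apply/cV2_eqP; rewrite !mxE; split; field. Qed.

Lemma unique_sliding_interp (R : realType) (X : pws_system R) (x : R) :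
  (exists! w : R * R, [/\ 0 < w.1 < 1, 0 < w.2 < 1
    & bilinear_interp (Xtilde X x 1) (Xtilde X x 2) (Xtilde X x 3) (Xtilde X x 4)
        w.1 w.2 = 0]) -> unique_sliding X x.
Proof.
case=> -[s t] [] [] /= /andP[s0 s1] /andP[t0 t1] F0 uniq.
have half (u : R) : (1 + (2 * u - 1)) / 2 = u by field.
exists (2 * s - 1, 2 * t - 1, sliding_vector X x (2 * s - 1) (2 * t - 1)).
split=> [|[[psi phi] v]] /=.
  by split=> //; [lra | lra | rewrite FtildeE !half].
case=> [] /= /andP[p0 p1] /andP[q0 q1] F ->.
have [sE tE] : (s, t) = ((1 + psi) / 2, (1 + phi) / 2).
  by apply: uniq; split=> /=;
    [apply/andP; split; lra | apply/andP; split; lra | rewrite -FtildeE].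
have -> : 2 * s - 1 = psi by rewrite sE; field.
by have -> : 2 * t - 1 = phi by rewrite tE; field.
Qed.

(** Puts the crossing of the diagonal case into the form of the edge case with the second and fourth
    vectors exchanged. *)
Lemma segments_cross_rev (R : realType) (a b c d : 'cV[R]_2) :
  segments_cross a b c d -> segments_cross d c b a.
Proof.
case=> s [t [/andP[s0 s1] /andP[t0 t1] E]]; exists (1 - t), (1 - s).
by split; [apply/andP; split; lra | apply/andP; split; lra |];
  rewrite !subKr addrC -E addrC.
Qed.

Lemma bilinear_interp_swap (R : realType) (X1 X2 X3 X4 : 'cV[R]_2) (s t : R) :
  bilinear_interp X1 X4 X3 X2 t s = bilinear_interp X1 X2 X3 X4 s t.
Proof. by apply/cV2_eqP; rewrite !mxE; split; ring. Qed.

Theorem proposition4 (R : realType) (X : pws_system R) (x : R)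
    (hx : x \in pws_itv X)
    (hcrossed : crossed_projection (Xtilde X x)) :
  (is_edge (Xtilde X x) 1 ->
   det2 (Xtilde X x 1) (Xtilde X x 2) * det2 (Xtilde X x 3) (Xtilde X x 4) < 0 ->
   0 < det2 (Xtilde X x 2) (Xtilde X x 3) * det2 (Xtilde X x 4) (Xtilde X x 1) ->
   unique_sliding X x)
  /\
  (is_diagonal (Xtilde X x) 1 ->
   0 < det2 (Xtilde X x 1) (Xtilde X x 2) * det2 (Xtilde X x 3) (Xtilde X x 4) ->
   det2 (Xtilde X x 2) (Xtilde X x 3) * det2 (Xtilde X x 4) (Xtilde X x 1) < 0 ->
   unique_sliding X x).
Proof.
have e12 : (1 + 1 : 'Z_4) = 2 by apply/val_inj.
have e13 : (1 + 2 : 'Z_4) = 3 by apply/val_inj.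
have e14 : (1 + 3 : 'Z_4) = 4 by apply/val_inj.
rewrite /is_edge /is_diagonal e12 e13 e14.
have det2C (a b : 'cV[R]_2) : det2 a b = - det2 b a by rewrite !det2E; ring.
split=> [nd|c] d1 d2; apply: unique_sliding_interp.
  have [//|c] := crossed_projection_cross hcrossed.
  exact: bilinear_interp_unique_zero.
(* In both determinant conditions the exchange reverses the two factors of the product, and the two
   signs cancel. *)
have [||[t s] [[t01 s01 F] uniq]] :=
  bilinear_interp_unique_zero (segments_cross_rev c).
- by rewrite (det2C _ (_ 4)) (det2C _ (_ 2)) mulrNN mulrC.
- by rewrite (det2C _ (_ 3)) (det2C _ (_ 1)) mulrNN mulrC.
exists (s, t); split=> [|[s' t'] [s'01 t'01 F']].
  by split=> //; rewrite -bilinear_interp_swap.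
have [-> ->] // : (t, s) = (t', s').
by apply: uniq; split=> //; rewrite bilinear_interp_swap.
Qed.
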